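(* Let $a$ and $b$ be arbitrary complex numbers such that $a+b-\frac12$ is not a negative integer. Then $$2\sum_{n=1}^\infty\frac{(2a)_n(2b)_n}{n!\left(a+b+\frac12\right)_n}\frac{H_n}{2^n}=\sum_{n=1}^\infty\frac{(a)_n(b)_n}{n!\left(a+b+\frac12\right)_n}H_n,$$ and $$4\sum_{n=1}^\infty\frac{(2a)_n(2b)_n}{n!\left(a+b+\frac12\right)_n}\frac{H_n^2+H_n^{(2)}}{2^n}=\sum_{n=1}^\infty\frac{(a)_n(b)_n}{n!\left(a+b+\frac12\right)_n}\left(H_n^2+H_n^{(2)}\right).$$
   Context: $(x)_n=x(x+1)\cdots(x+n-1)$ is the Pochhammer symbol (with $(x)_0=1$). $H_n=\sum_{k=1}^n\frac1k$ is the $n$-th harmonic number and $H_n^{(2)}=\sum_{k=1}^n\frac1{k^2}$; $H_n^2$ means $(H_n)^2$. *)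

(* Defs.v *)
From Stdlib Require Import Reals ZArith.
From Coquelicot Require Import Coquelicot.

Open Scope C_scope.

Fixpoint pochhammer (x : C) (n : nat) : C :=
  match n with
  | O => 1
  | S m => pochhammer x m * (x + RtoC (INR m))
  end.

(** [harmonic r n] is H_n^(r); [sum_n_m _ 1 0] is the empty sum. *)
Definition harmonic (r n : nat) : R :=
  sum_n_m (fun k => (1 / INR k ^ r)%R) 1 n.

(** The coefficient of [x^n] in Gauss's series 2F1(a, b; c; x). *)
Definition gauss_coef (a b c : C) (n : nat) : C :=
  (pochhammer a n * pochhammer b n) / (RtoC (INR (fact n)) * pochhammer c n).

(** The series of the [u n] over [n >= 1] (so [u 0] is dropped) converges
    in [C], with sum [s]. *)
Definition is_sum_from1 (u : nat -> C) (s : C) : Prop :=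
  @is_series C_AbsRing C_NormedModule (fun k => u (S k)) s.

(* Main.v *)
Require Import Defs.
From Stdlib Require Import Reals ZArith Lra Lia.
From Coquelicot Require Import Coquelicot.

(** Put [c = a + b + 1/2].  Gauss's quadratic transformation
    2F1(2a, 2b; c; y/2) = 2F1(a, b; c; y(2-y)) has the variables related by
    x = y(2-y), that is, y = 1 - sqrt(1-x).  It is used here coefficient by
    coefficient.  Let t(m,n) be the coefficient of x^n in
    (1 - sqrt(1-x))^m ([root_coef]), let p_m be the coefficient of y^m on the
    left ([half_coef]) and g_n that of x^n on the right.  Substituting
    y = 1 - sqrt(1-x) in the series in y gives
    [g_n = sum_(m <= n) t(m,n) p_m] ([gauss_coef_quadratic]), a finite sum,
    which is proved directly from the first-order recurrences of g, p and t.

    This direction of the substitution has the advantage that t(m,n) >= 0 and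
    t(m,n) = 0 for n < m.  Hence, for weights W_n >= 0,
    [sum_n g_n W_n = sum_m p_m (sum_n t(m,n) W_n)] as soon as the right-hand
    side converges absolutely ([triangular_series]), which it does because
    p_m decreases geometrically ([half_coef_summable]); the convergence of the
    series of the g_n W_n, whose terms only decrease like a power of n, comes
    out for free.

    It remains to see that the harmonic weights are eigenvectors of t:
    [sum_n t(m,n) H_n = 2 H_m] and
    [sum_n t(m,n) (H_n^2 + H_n^(2)) = 4 (H_m^2 + H_m^(2))].
    The reason is [root_coef_moment]: if the weights V satisfy
    [sum_n t(m,n) V_n = l V_m], then the weights W with
    [W_(n+1) - W_n = V_(n+1) / (n+1)] satisfy the same relation up to a
    constant, with 2l in place of l.  (For the functionals that a weight
    defines on power series, this passage is dual to inverting the operator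
    w d/dw, where w = 1 - y; since 1 - x = w^2, the corresponding operator in x
    is half of it.)  One starts from V = 0, W = 1, where the relation says
    [sum_n t(m,n) = 1], then takes V = 1, W = H, and finally V = 2H,
    W = H^2 + H^(2). *)

(** * Coefficients of the powers of 1 - sqrt(1 - x) *)

Open Scope R_scope.

Lemma sum_n_succ (u : nat -> R) (n : nat) :
  sum_n u (S n) = sum_n u n + u (S n).
Proof. exact (sum_Sn u n). Qed.

Lemma is_series_of_partial_sums (u : nat -> R) (l : R) :
  is_lim_seq (sum_n u) l -> is_series u l.
Proof. exact (fun H => H). Qed.

Lemma INR_succ_neq0 (n : nat) : INR n + 1 <> 0.
Proof. pose proof (pos_INR n); lra. Qed.

(** The coefficient of x^n in f^m, where f = 1 - sqrt(1-x).  From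
    (1-x) f' = (1-f)/2 one gets (1-x) (f^m)' = (m/2) (f^(m-1) - f^m), and
    comparing the coefficients of x^n gives the recursion on [n]. When
    [m = 0] the term with [pred m] has coefficient 0. *)
Fixpoint root_coef (m n : nat) : R :=
  match n with
  | O => match m with O => 1 | S _ => 0 end
  | S n' => ((INR n' - INR m / 2) * root_coef m n'
             + INR m / 2 * root_coef (pred m) n') / (INR n' + 1)
  end.

Lemma root_coef_S (m n : nat) :
  (INR n + 1) * root_coef m (S n) =
  (INR n - INR m / 2) * root_coef m n + INR m / 2 * root_coef (pred m) n.
Proof. simpl; field; apply INR_succ_neq0. Qed.

Lemma root_coef_0_S (n : nat) : root_coef 0 (S n) = 0.
Proof.
  induction n as [|n IH]; [simpl; field|].
  apply (Rmult_eq_reg_l (INR (S n) + 1)); [|apply INR_succ_neq0].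
  rewrite root_coef_S; cbn [pred]; rewrite IH; cbn [INR]; ring.
Qed.

Lemma root_coef_lt (m n : nat) : (n < m)%nat -> root_coef m n = 0.
Proof.
  revert m; induction n as [|n IH]; intros m Hm.
  - destruct m; [lia|reflexivity].
  - apply (Rmult_eq_reg_l (INR n + 1)); [|apply INR_succ_neq0].
    rewrite root_coef_S, !IH by lia; ring.
Qed.

(** The only negative coefficient in the recursion is n - m/2 for n < m/2,
    and there it multiplies a coefficient that vanishes. *)
Lemma root_coef_ge0 (m n : nat) : 0 <= root_coef m n.
Proof.
  revert m; induction n as [|n IH]; intros m.
  - destruct m; simpl; lra.
  - pose proof (pos_INR n) as Hn; pose proof (pos_INR m) as Hm.
    apply (Rmult_le_reg_l (INR n + 1)); [lra|].
    rewrite Rmult_0_r, root_coef_S.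
    assert (0 <= INR m / 2 * root_coef (pred m) n)
      by (apply Rmult_le_pos; [lra|apply IH]).
    destruct (Nat.le_gt_cases m n) as [Hmn|Hmn].
    + apply le_INR in Hmn.
      assert (0 <= (INR n - INR m / 2) * root_coef m n)
        by (apply Rmult_le_pos; [lra|apply IH]).
      lra.
    + rewrite (root_coef_lt m n) by exact Hmn; lra.
Qed.

(** A second relation, in the direction of [m], because the coefficients
    form a hypergeometric term: for 1 <= m <= n they equal
    m/(2n-m) binomial(2n-m, n) 2^(m-2n).  Together with the recursion it
    yields the recurrence of the transformed series. *)
Lemma root_coef_contiguous (k n : nat) :
  INR k * (2 * INR n - INR k - 1) * root_coef (S k) n =
  2 * (INR k + 1) * (INR n - INR k) * root_coef k n.
Proof.
  revert k; induction n as [|n IH]; intros k.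
  - destruct k; cbn [root_coef INR]; ring.
  - destruct k as [|k].
    + rewrite root_coef_0_S; cbn [INR]; ring.
    + apply (Rmult_eq_reg_l (INR n + 1)); [|apply INR_succ_neq0].
      pose proof (root_coef_S (S (S k)) n) as E2.
      pose proof (root_coef_S (S k) n) as E1.
      pose proof (IH k) as I1.
      pose proof (IH (S k)) as I2.
      cbn [pred] in E1, E2.
      rewrite ?S_INR in *.
      set (p := root_coef (S (S k)) (S n)) in *.
      set (q := root_coef (S k) (S n)) in *.
      set (u := root_coef (S (S k)) n) in *.
      set (v := root_coef (S k) n) in *.
      set (w := root_coef k n) in *.
      set (x := INR n) in *. set (y := INR k) in *.
      transitivity ((y + 1) * (2 * (x + 1) - (y + 1) - 1) * ((x + 1) * p)); [ring|].
      transitivity (2 * (y + 1 + 1) * (x + 1 - (y + 1)) * ((x + 1) * q)); [|ring].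
      rewrite E1, E2.
      (* The two recursions leave a combination of the induction hypotheses for
         k and k+1; the factors make the terms in u and w agree. *)
      apply Rminus_diag_uniq.
      transitivity ((2 * x - y) / 2 * ((y + 1) * (2 * x - (y + 1) - 1) * u
                                      - 2 * (y + 1 + 1) * (x - (y + 1)) * v)
                    + (y + 2) / 2 * (y * (2 * x - y - 1) * v
                                      - 2 * (y + 1) * (x - y) * w)); [field|].
      rewrite I1, I2; ring.
Qed.

(** * Weighted sums of the coefficients *)

(** Summation by parts: the recursion reads
    (n+1) t(m+1,n+1) - n t(m+1,n) = (m+1)/2 (t(m,n) - t(m+1,n)), and it is
    multiplied by W_n and summed over n <= N. *)
Lemma root_coef_moment_partial (V W : nat -> R) (m N : nat)
  (HW : forall n, W (S n) = W n + V (S n) / (INR n + 1)) :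
  (INR N + 1) * (W (S N) * root_coef (S m) (S N)) =
  (INR m + 1) / 2 * (sum_n (fun n => W n * root_coef m n) N
                     - sum_n (fun n => W n * root_coef (S m) n) N)
  + sum_n (fun n => V n * root_coef (S m) n) (S N).
Proof.
  assert (step : forall n, (INR n + 1) * (W (S n) * root_coef (S m) (S n)) =
    INR n * (W n * root_coef (S m) n)
    + (INR m + 1) / 2 * (W n * root_coef m n - W n * root_coef (S m) n)
    + V (S n) * root_coef (S m) (S n)).
  { intros n; rewrite HW.
    transitivity (W n * ((INR n + 1) * root_coef (S m) (S n))
                  + V (S n) * root_coef (S m) (S n)).
    - field; apply INR_succ_neq0.
    - rewrite root_coef_S, S_INR; cbn [pred]; field. }
  induction N as [|N IH].
  - rewrite step, sum_n_succ, !sum_O.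
    rewrite (root_coef_lt (S m) 0) by lia; cbn [INR]; ring.
  - rewrite step, S_INR, IH, !sum_n_succ; ring.
Qed.

(** Otherwise [u] would dominate a multiple of the harmonic series.  This
    makes the boundary term of the summation by parts vanish in the limit
    without any estimate of t(m,n). *)
Lemma summable_scaled_limit_eq0 (u : nat -> R) (l : R) :
  (forall n, 0 <= u n) -> ex_series u ->
  is_lim_seq (fun n => (INR n + 1) * u (S n)) l -> l = 0.
Proof.
  intros u_ge0 [s Hs] Hl.
  assert (l_ge0 : Rbar_le 0 l).
  { apply (is_lim_seq_le (fun _ => 0) (fun n => (INR n + 1) * u (S n)));
      [|apply is_lim_seq_const|exact Hl].
    intros n; apply Rmult_le_pos; [pose proof (pos_INR n); lra|apply u_ge0]. }
  cbn in l_ge0.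
  destruct (Req_dec l 0) as [|l_neq0]; [assumption|exfalso].
  assert (l_gt0 : 0 < l / 4) by lra.
  apply is_lim_seq_spec in Hl.
  destruct (Hl (mkposreal _ l_gt0)) as [N1 H1].
  assert (Hs' : is_lim_seq (sum_n u) s) by exact Hs.
  apply is_lim_seq_spec in Hs'.
  destruct (Hs' (mkposreal (l / 16) ltac:(lra))) as [N2 H2].
  cbn [pos] in H1, H2.
  set (N := S (N1 + N2)).
  (* As in Oresme's argument, the block of indices N < n <= 2N contributes at
     least l/4 to the sum. *)
  assert (block : forall k, (k <= N)%nat ->
     INR k * (l / 2 / (2 * INR N)) <= sum_n u (N + k) - sum_n u N).
  { assert (0 < INR N) by (apply lt_0_INR; unfold N; lia).
    induction k as [|k IH]; intros Hk.
    - rewrite Nat.add_0_r; cbn [INR]; lra.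
    - rewrite Nat.add_succ_r, sum_n_succ, S_INR.
      specialize (IH ltac:(lia)).
      specialize (H1 (N + k)%nat ltac:(unfold N; lia)).
      apply Rabs_def2 in H1.
      assert (INR (N + k) + 1 <= 2 * INR N).
      { apply le_INR in Hk; rewrite S_INR in Hk; rewrite plus_INR; lra. }
      assert (l / 2 / (2 * INR N) <= u (S (N + k))).
      { apply Rle_div_l; [lra|].
        pose proof (u_ge0 (S (N + k))) as Hu.
        apply (Rle_trans _ ((INR (N + k) + 1) * u (S (N + k)))); [lra|].
        rewrite Rmult_comm; apply Rmult_le_compat_l; lra. }
      lra. }
  specialize (block N (le_n N)).
  assert (0 < INR N) by (apply lt_0_INR; unfold N; lia).
  replace (INR N * (l / 2 / (2 * INR N))) with (l / 4) in block by (field; lra).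
  pose proof (H2 N ltac:(unfold N; lia)) as B1.
  pose proof (H2 (N + N)%nat ltac:(unfold N; lia)) as B2.
  apply Rabs_def2 in B1; apply Rabs_def2 in B2; lra.
Qed.

(** Letting N tend to infinity in [root_coef_moment_partial], the sums A_m of
    t(m,n) W_n satisfy A_(m+1) - A_m = 2/(m+1) lambda V_(m+1)
    = 2 lambda (W_(m+1) - W_m).  The sum for m+1 converges because all
    terms, including the boundary term, are nonnegative, so that the identity
    bounds its partial sums. *)
Lemma root_coef_moment (V W : nat -> R) (lambda : R)
  (V_ge0 : forall n, 0 <= V n) (W_ge0 : forall n, 0 <= W n)
  (HW : forall n, W (S n) = W n + V (S n) / (INR n + 1))
  (HV : forall m, is_series (fun n => V n * root_coef m n) (lambda * V m)) :
  forall m, is_series (fun n => W n * root_coef m n)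
              (W O + 2 * lambda * (W m - W O)).
Proof.
  induction m as [|m IH].
  - replace (W O + 2 * lambda * (W O - W O)) with (W O) by ring.
    apply is_series_of_partial_sums, (is_lim_seq_ext (fun _ => W O));
      [|apply is_lim_seq_const].
    induction n as [|n IHn].
    + rewrite sum_O; cbn; ring.
    + rewrite sum_n_succ, <- IHn, root_coef_0_S; ring.
  - set (A := W O + 2 * lambda * (W m - W O)) in *.
    specialize (HV (S m)).
    set (B := lambda * V (S m)) in *.
    assert (term_ge0 : forall X : nat -> R, (forall n, 0 <= X n) ->
              forall k n, 0 <= X n * root_coef k n)
      by (intros; apply Rmult_le_pos; [auto|apply root_coef_ge0]).
    assert (partial_le : forall X k l, (forall n, 0 <= X n) ->
              is_series (fun n => X n * root_coef k n) l ->
              forall N, sum_n (fun n => X n * root_coef k n) N <= l).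
    { intros X k l HX Hl N.
      apply (is_lim_seq_incr_compare (sum_n (fun n => X n * root_coef k n)));
        [exact Hl|].
      intros n; rewrite sum_n_succ.
      pose proof (term_ge0 X HX k (S n)); lra. }
    pose proof (pos_INR m) as Hm.
    assert (conv : ex_finite_lim_seq
              (sum_n (fun n => W n * root_coef (S m) n))).
    { apply (ex_finite_lim_seq_incr _ (A + 2 * B / (INR m + 1))).
      - intros n; rewrite sum_n_succ.
        pose proof (term_ge0 W W_ge0 (S m) (S n)); lra.
      - intros N.
        pose proof (root_coef_moment_partial V W m N HW) as E.
        pose proof (partial_le W m A W_ge0 IH N).
        pose proof (partial_le V (S m) B V_ge0 HV (S N)).
        assert (0 <= (INR N + 1) * (W (S N) * root_coef (S m) (S N))).
        { apply Rmult_le_pos; [pose proof (pos_INR N); lra|auto]. }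
        apply (Rmult_le_reg_l ((INR m + 1) / 2)); [lra|].
        replace ((INR m + 1) / 2 * (A + 2 * B / (INR m + 1)))
          with ((INR m + 1) / 2 * A + B) by (field; lra).
        assert ((INR m + 1) / 2 * sum_n (fun n => W n * root_coef m n) N
                <= (INR m + 1) / 2 * A) by (apply Rmult_le_compat_l; lra).
        lra. }
    destruct conv as [A' HA'].
    (* The boundary term converges, hence to 0. *)
    assert (limit : (INR m + 1) / 2 * (A - A') + B = 0).
    { apply (summable_scaled_limit_eq0 (fun n => W n * root_coef (S m) n)).
      - auto.
      - exists A'; exact HA'.
      - eapply is_lim_seq_ext.
        + intros N; symmetry; apply (root_coef_moment_partial V W m N HW).
        + apply is_lim_seq_plus'.
          * apply (is_lim_seq_scal_l _ _ (A - A')).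
            apply is_lim_seq_minus'; [exact IH|exact HA'].
          * apply -> is_lim_seq_incr_1; exact HV. }
    assert (HA : A' = W O + 2 * lambda * (W (S m) - W O)).
    { rewrite HW.
      apply (Rmult_eq_reg_l ((INR m + 1) / 2)); [|lra].
      transitivity ((INR m + 1) / 2 * A + B); [lra|].
      unfold A, B; field; lra. }
    rewrite <- HA; exact HA'.
Qed.

(** * Harmonic weights *)

Lemma harmonic_S (r n : nat) :
  harmonic r (S n) = harmonic r n + 1 / (INR n + 1) ^ r.
Proof.
  unfold harmonic; rewrite sum_n_Sm by lia; rewrite S_INR; reflexivity.
Qed.

Lemma harmonic_0 (r : nat) : harmonic r 0 = 0.
Proof. exact (sum_n_m_zero (G:=R_AbelianMonoid) _ 1 0 (le_n 1)). Qed.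

Lemma harmonic_ge0 (r n : nat) : 0 <= harmonic r n.
Proof.
  induction n as [|n IH]; [rewrite harmonic_0; lra|rewrite harmonic_S].
  pose proof (pos_INR n) as Hn.
  assert (0 < (INR n + 1) ^ r) by (apply pow_lt; lra).
  assert (0 < 1 / (INR n + 1) ^ r) by (apply Rdiv_lt_0_compat; lra).
  lra.
Qed.

Lemma root_coef_sum (m : nat) : is_series (root_coef m) 1.
Proof.
  apply (is_series_ext (fun n => 1 * root_coef m n)); [intros n; apply Rmult_1_l|].
  replace (is_series (fun n => 1 * root_coef m n) 1)
    with (is_series (fun n => 1 * root_coef m n) (1 + 2 * 0 * (1 - 1)))
    by (f_equal; ring).
  apply (root_coef_moment (fun _ => 0) (fun _ => 1)); intros; try lra.
  apply is_series_of_partial_sums, (is_lim_seq_ext (fun _ => 0));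
    [|rewrite Rmult_0_l; apply is_lim_seq_const].
  induction n as [|n IHn].
  - rewrite sum_O; ring.
  - rewrite sum_n_succ, <- IHn; ring.
Qed.

Lemma root_coef_sum_harmonic (m : nat) :
  is_series (fun n => harmonic 1 n * root_coef m n) (2 * harmonic 1 m).
Proof.
  replace (2 * harmonic 1 m)
    with (harmonic 1 0 + 2 * 1 * (harmonic 1 m - harmonic 1 0))
    by (rewrite harmonic_0; ring).
  apply (root_coef_moment (fun _ => 1)); intros; try lra.
  - apply harmonic_ge0.
  - rewrite harmonic_S; field; apply INR_succ_neq0.
  - rewrite Rmult_1_l.
    apply (is_series_ext (root_coef m0));
      [intros n; symmetry; apply Rmult_1_l|apply root_coef_sum].
Qed.

(** The weights arise from 2H because
    H_(n+1)^2 - H_n^2 + 1/(n+1)^2 = 2 H_(n+1) / (n+1). *)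
Lemma root_coef_sum_harmonic_sq (m : nat) :
  is_series (fun n => (harmonic 1 n ^ 2 + harmonic 2 n) * root_coef m n)
    (4 * (harmonic 1 m ^ 2 + harmonic 2 m)).
Proof.
  set (K := fun n => harmonic 1 n ^ 2 + harmonic 2 n).
  assert (K0 : K O = 0) by (unfold K; rewrite !harmonic_0; ring).
  replace (4 * (harmonic 1 m ^ 2 + harmonic 2 m))
    with (K O + 2 * 2 * (K m - K O)) by (rewrite K0; unfold K; ring).
  apply (root_coef_moment (fun n => 2 * harmonic 1 n) K); intros.
  - pose proof (harmonic_ge0 1 n); lra.
  - unfold K; pose proof (harmonic_ge0 2 n);
      pose proof (pow2_ge_0 (harmonic 1 n)); lra.
  - unfold K; rewrite !harmonic_S; field; apply INR_succ_neq0.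
  - replace (2 * (2 * harmonic 1 m0)) with (scal 2 (2 * harmonic 1 m0))
      by reflexivity.
    apply (is_series_ext (fun n => scal 2 (harmonic 1 n * root_coef m0 n))).
    + intros n; symmetry; apply Rmult_assoc.
    + exact (is_series_scal_l 2 _ _ (root_coef_sum_harmonic m0)).
Qed.

Lemma harmonic_le (r n : nat) : harmonic r n <= INR n.
Proof.
  induction n as [|n IH]; [rewrite harmonic_0; cbn [INR]; lra|].
  rewrite harmonic_S, S_INR.
  assert (1 <= (INR n + 1) ^ r)
    by (apply pow_R1_Rle; pose proof (pos_INR n); lra).
  assert (1 / (INR n + 1) ^ r <= 1) by (apply Rle_div_l; lra).
  lra.
Qed.

(** * Interchange of summations *)

(** Tannery's theorem in the form of a sum whose range grows with the
    parameter: the tail is dominated by that of [c], and a head of fixed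
    length tends to 0. *)
Lemma tannery (c : nat -> R) (d : nat -> nat -> R)
  (Hd : forall m N, 0 <= d m N <= c m) (Hc : ex_series c)
  (Hlim : forall m, is_lim_seq (d m) 0) :
  is_lim_seq (fun N => sum_n (fun m => d m N) N) 0.
Proof.
  assert (head : forall M, is_lim_seq (fun N => sum_n (fun m => d m N) M) 0).
  { induction M as [|M IH].
    - apply (is_lim_seq_ext (d O)); [intros N; symmetry; apply sum_O|auto].
    - replace 0 with (0 + 0) by ring.
      eapply is_lim_seq_ext;
        [intros N; symmetry; apply sum_n_succ|apply is_lim_seq_plus'; auto]. }
  assert (sum_ge0 : forall M N, 0 <= sum_n (fun m => d m N) M).
  { intros M N; induction M as [|M IH];
      [rewrite sum_O|rewrite sum_n_succ; specialize (Hd (S M) N)];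
      [apply Hd|lra]. }
  assert (tail : forall M k N, sum_n (fun m => d m N) (M + k)
            <= sum_n (fun m => d m N) M + (sum_n c (M + k) - sum_n c M)).
  { intros M k N; induction k as [|k IH]; [rewrite Nat.add_0_r; lra|].
    rewrite Nat.add_succ_r, !sum_n_succ; specialize (Hd (S (M + k)) N); lra. }
  destruct Hc as [s Hs].
  assert (Hs' : is_lim_seq (sum_n c) s) by exact Hs.
  apply is_lim_seq_spec in Hs'; apply is_lim_seq_spec; intros eps.
  destruct (Hs' (mkposreal (eps / 4) ltac:(pose proof (cond_pos eps); lra)))
    as [M HM].
  pose proof (head M) as HhM; apply is_lim_seq_spec in HhM.
  destruct (HhM (mkposreal (eps / 4) ltac:(pose proof (cond_pos eps); lra)))
    as [N0 HN0].
  cbn [pos] in HM, HN0.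
  exists (M + N0)%nat; intros N HN.
  pose proof (HN0 N ltac:(lia)) as B0; apply Rabs_def2 in B0.
  pose proof (HM M ltac:(lia)) as B1; apply Rabs_def2 in B1.
  pose proof (HM N ltac:(lia)) as B2; apply Rabs_def2 in B2.
  pose proof (tail M (N - M)%nat N) as Ht.
  replace (M + (N - M))%nat with N in Ht by lia.
  pose proof (sum_ge0 N N).
  rewrite Rminus_0_r, Rabs_pos_eq by lra.
  pose proof (cond_pos eps); lra.
Qed.

Open Scope C_scope.

Lemma sum_n_succ_C (u : nat -> C) (n : nat) :
  sum_n u (S n) = sum_n u n + u (S n).
Proof. exact (sum_Sn u n). Qed.

Lemma sum_n_RtoC (u : nat -> R) (n : nat) :
  RtoC (sum_n u n) = sum_n (fun k => RtoC (u k)) n.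
Proof.
  induction n as [|n IH]; [rewrite !sum_O; reflexivity|].
  rewrite sum_n_succ, sum_n_succ_C, RtoC_plus, IH; reflexivity.
Qed.

Lemma sum_n_truncate (u : nat -> C) (n N : nat) :
  (n <= N)%nat -> (forall k, (n < k)%nat -> u k = 0) -> sum_n u N = sum_n u n.
Proof.
  intros HnN Hu; induction HnN as [|N HnN IH]; [reflexivity|].
  rewrite sum_n_succ_C, IH, Hu by lia; apply Cplus_0_r.
Qed.

Lemma triangular_switch (T : nat -> nat -> R) (p : nat -> C) (N : nat)
  (T_lt : forall m n, (n < m)%nat -> T m n = 0%R) :
  sum_n (fun n => sum_n (fun m => RtoC (T m n) * p m) n) N
  = sum_n (fun m => p m * RtoC (sum_n (T m) N)) N.
Proof.
  transitivity (sum_n (fun n => sum_n (fun m => RtoC (T m n) * p m) N) N).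
  - apply sum_n_ext_loc; intros n Hn.
    symmetry; apply sum_n_truncate; [exact Hn|].
    intros m Hm; rewrite T_lt by exact Hm; apply Cmult_0_l.
  - rewrite sum_n_switch; apply sum_n_ext; intros m.
    rewrite sum_n_RtoC, <- (sum_n_mult_l (K:=C_Ring)).
    apply sum_n_ext; intros n; apply Cmult_comm.
Qed.

(** Fubini for a nonnegative triangular array.  A partial sum over n <= N is
    the sum over m <= N of p_m times the N-th partial sum of the m-th row
    of [T]; its difference [D] with the partial sum of [p_m A_m] tends to 0 by
    Tannery's theorem, with dominating terms |p_m| A_m. *)
Lemma triangular_series (T : nat -> nat -> R) (A : nat -> R) (p : nat -> C)
  (s : C)
  (T_ge0 : forall m n, (0 <= T m n)%R)
  (T_lt : forall m n, (n < m)%nat -> T m n = 0%R)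
  (T_sum : forall m, is_series (T m) (A m))
  (pA_abs : ex_series (fun m => (Cmod (p m) * A m)%R))
  (pA_sum : @is_series C_AbsRing C_NormedModule (fun m => p m * RtoC (A m)) s) :
  @is_series C_AbsRing C_NormedModule
    (fun n => sum_n (fun m => RtoC (T m n) * p m) n) s.
Proof.
  set (D := fun N => sum_n (fun m => p m * RtoC (A m - sum_n (T m) N)) N).
  assert (partial_le : forall m N, (sum_n (T m) N <= A m)%R).
  { intros m N; apply (is_lim_seq_incr_compare (sum_n (T m)));
      [apply T_sum|].
    intros n; rewrite sum_n_succ; pose proof (T_ge0 m (S n)); lra. }
  assert (partial_ge0 : forall m N, (0 <= sum_n (T m) N)%R).
  { intros m N; induction N as [|N IH];
      [rewrite sum_O; apply T_ge0
      |rewrite sum_n_succ; pose proof (T_ge0 m (S N)); lra]. }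
  assert (D_lim : filterlim D eventually (locally (zero : C_NormedModule))).
  { apply filterlim_norm_zero.
    assert (HT : is_lim_seq (fun N => sum_n
              (fun m => (Cmod (p m) * (A m - sum_n (T m) N))%R) N) 0).
    { apply (tannery (fun m => (Cmod (p m) * A m)%R)
               (fun m N => (Cmod (p m) * (A m - sum_n (T m) N))%R)).
      - intros m N; specialize (partial_le m N); specialize (partial_ge0 m N).
        pose proof (Cmod_ge_0 (p m)); split.
        + apply Rmult_le_pos; lra.
        + apply Rmult_le_compat_l; lra.
      - exact pA_abs.
      - intros m.
        replace 0%R with (Cmod (p m) * (A m - A m))%R by ring.
        apply (is_lim_seq_scal_l _ _ (A m - A m)%R).
        apply is_lim_seq_minus'; [apply is_lim_seq_const|apply T_sum]. }
    apply (is_lim_seq_le_le (fun _ => 0%R) (fun N => norm (D N)) _ 0%R) in HT;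
      [exact HT| |apply is_lim_seq_const].
    intros N; split; [apply norm_ge_0|].
    unfold D.
    eapply Rle_trans;
      [exact (norm_sum_n_m (V:=C_NormedModule)
         (fun m => p m * RtoC (A m - sum_n (T m) N)) 0 N)|].
    apply Req_le, sum_n_ext; intros m.
    transitivity (Cmod (p m * RtoC (A m - sum_n (T m) N))); [reflexivity|].
    rewrite Cmod_mult, Cmod_R, Rabs_pos_eq; [reflexivity|].
    specialize (partial_le m N); lra. }
  assert (HD : filterlim (fun N => plus (sum_n (fun m => p m * RtoC (A m)) N)
       (opp (D N))) eventually
       (locally (plus s (opp zero) : C_NormedModule))).
  { eapply filterlim_comp_2;
      [exact pA_sum| |exact (filterlim_plus (V:=C_NormedModule) s (opp zero))].
    eapply filterlim_comp; [exact D_lim|].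
    exact (filterlim_opp (V:=C_NormedModule) zero). }
  rewrite opp_zero, plus_zero_r in HD.
  eapply filterlim_ext; [|exact HD].
  intros N.
  transitivity (sum_n (fun m => p m * RtoC (sum_n (T m) N)) N);
    [|symmetry; exact (triangular_switch T p N T_lt)].
  assert (E : sum_n (fun m => p m * RtoC (A m)) N
              = sum_n (fun m => p m * RtoC (sum_n (T m) N)) N + D N).
  { etransitivity; [|exact (sum_n_plus (G:=C_AbelianMonoid) _ _ N)].
    apply sum_n_ext; intros m.
    change (p m * RtoC (A m) = p m * RtoC (sum_n (T m) N)
                               + p m * RtoC (A m - sum_n (T m) N)).
    rewrite RtoC_minus; ring. }
  change (sum_n (fun m => p m * RtoC (A m)) N - D N
          = sum_n (fun m => p m * RtoC (sum_n (T m) N)) N).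
  rewrite E; ring.
Qed.

(** * Hypergeometric coefficients *)

Lemma gauss_coef_S (a b c : C) (n : nat)
  (Hc : forall k : nat, c + RtoC (INR k) <> 0) :
  (RtoC (INR n) + 1) * (c + RtoC (INR n)) * gauss_coef a b c (S n)
  = (a + RtoC (INR n)) * (b + RtoC (INR n)) * gauss_coef a b c n.
Proof.
  assert (Hp : pochhammer c n <> 0).
  { induction n as [|n IH]; cbn [pochhammer].
    - exact C1_nz.
    - apply Cmult_neq_0; [exact IH|apply Hc]. }
  assert (Hf : RtoC (INR (fact n)) <> 0)
    by (intros E; apply (INR_fact_neq_0 n), RtoC_inj, E).
  assert (Hn : RtoC (INR n) + 1 <> 0)
    by (rewrite <- RtoC_plus; intros E; apply (INR_succ_neq0 n), RtoC_inj, E).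
  unfold gauss_coef; cbn [pochhammer].
  rewrite fact_simpl, mult_INR, S_INR, RtoC_mult, RtoC_plus.
  field; repeat split; auto.
Qed.

Lemma ex_series_ratio (u : nat -> R) (r : R) (N : nat)
  (u_ge0 : forall n, (0 <= u n)%R) (r_bound : (0 <= r < 1)%R)
  (Hr : forall n, (N <= n)%nat -> (u (S n) <= r * u n)%R) :
  ex_series u.
Proof.
  apply (ex_series_incr_n u N).
  apply (ex_series_le (V:=R_CompleteNormedModule) _
           (fun k => (u N * r ^ k)%R)).
  - intros k.
    change (Rabs (u (N + k)%nat) <= u N * r ^ k)%R.
    rewrite Rabs_pos_eq by auto.
    induction k as [|k IH]; [rewrite Nat.add_0_r; cbn [pow]; lra|].
    rewrite Nat.add_succ_r; cbn [pow].
    apply (Rle_trans _ _ _ (Hr (N + k)%nat ltac:(lia))).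
    replace (u N * (r * r ^ k))%R with (r * (u N * r ^ k))%R by ring.
    apply Rmult_le_compat_l; [lra|exact IH].
  - apply (ex_series_scal_l (V:=R_NormedModule) (u N)).
    apply ex_series_geom; rewrite Rabs_pos_eq; lra.
Qed.

Definition half_coef (a b c : C) (m : nat) : C :=
  gauss_coef a b c m * RtoC (/ 2 ^ m).

Lemma half_coef_S (a b c : C) (m : nat)
  (Hc : forall k : nat, c + RtoC (INR k) <> 0) :
  2 * (RtoC (INR m) + 1) * (c + RtoC (INR m)) * half_coef a b c (S m)
  = (a + RtoC (INR m)) * (b + RtoC (INR m)) * half_coef a b c m.
Proof.
  unfold half_coef.
  replace (/ 2 ^ m)%R with (2 * / 2 ^ S m)%R
    by (cbn [pow]; field; apply pow_nonzero; lra).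
  rewrite RtoC_mult.
  transitivity (2 * ((RtoC (INR m) + 1) * (c + RtoC (INR m))
     * gauss_coef a b c (S m)) * RtoC (/ 2 ^ S m)); [ring|].
  rewrite gauss_coef_S by exact Hc; ring.
Qed.

(** The ratio of consecutive terms tends to 1/2.  The factor (m+1)^2 is there
    to dominate H_m and H_m^2 + H_m^(2). *)
Lemma half_coef_summable (a b c : C)
  (Hc : forall k : nat, c + RtoC (INR k) <> 0) :
  ex_series (fun m => (Cmod (half_coef a b c m) * (INR m + 1) ^ 2)%R).
Proof.
  (* Beyond this bound each of the factors a+n, b+n, c+n and n+2 differs from
     n, n, n and n+1 by at most a twentieth, and 3/5 (21/20)^2 < 3/4. *)
  destruct (INR_unbounded (20 * (Cmod a + Cmod b + Cmod c + 1))) as [N HN].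
  apply (ex_series_ratio _ (3 / 4) N); [|lra|].
  { intros n; apply Rmult_le_pos; [apply Cmod_ge_0|apply pow2_ge_0]. }
  intros n Hn; apply le_INR in Hn.
  pose proof (Cmod_ge_0 a); pose proof (Cmod_ge_0 b); pose proof (Cmod_ge_0 c).
  rewrite S_INR.
  pose proof (f_equal Cmod (half_coef_S a b c n Hc)) as E.
  rewrite <- RtoC_plus in E.
  rewrite !Cmod_mult, !Cmod_R in E.
  set (x := INR n) in *.
  rewrite !Rabs_pos_eq in E by lra.
  set (q := Cmod (half_coef a b c (S n))) in *.
  set (p := Cmod (half_coef a b c n)) in *.
  assert (p_ge0 : (0 <= p)%R) by apply Cmod_ge_0.
  assert (q_ge0 : (0 <= q)%R) by apply Cmod_ge_0.
  assert (Rabs_x : Cmod (RtoC x) = x) by (rewrite Cmod_R; apply Rabs_pos_eq; lra).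
  assert (Ha : (Cmod (a + RtoC x) <= 21 / 20 * x)%R).
  { pose proof (Cmod_triangle a (RtoC x)); lra. }
  assert (Hb : (Cmod (b + RtoC x) <= 21 / 20 * x)%R).
  { pose proof (Cmod_triangle b (RtoC x)); lra. }
  assert (Hcx : (19 / 20 * x <= Cmod (c + RtoC x))%R).
  { pose proof (Cmod_triangle (c + RtoC x) (- c)) as Ht.
    replace (c + RtoC x + - c) with (RtoC x) in Ht by ring.
    rewrite Cmod_opp in Ht; lra. }
  assert (pq : (q <= 3 / 5 * p)%R).
  { pose proof (Cmod_ge_0 (a + RtoC x)); pose proof (Cmod_ge_0 (b + RtoC x)).
    assert (L : (2 * (x + 1) * (19 / 20 * x) * q
                 <= 2 * (x + 1) * Cmod (c + RtoC x) * q)%R).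
    { apply Rmult_le_compat_r; [lra|]; apply Rmult_le_compat_l; lra. }
    assert (U : (Cmod (a + RtoC x) * Cmod (b + RtoC x) * p
                 <= 21 / 20 * x * (21 / 20 * x) * p)%R).
    { apply Rmult_le_compat_r; [lra|]; apply Rmult_le_compat; lra. }
    rewrite E in L.
    apply (Rmult_le_reg_l (x * (x + 1))); [apply Rmult_lt_0_compat; lra|].
    assert (0 <= x * p)%R by (apply Rmult_le_pos; lra).
    assert (0 <= x * (x * p))%R by (apply Rmult_le_pos; lra).
    lra. }
  apply (Rle_trans _ (3 / 5 * p * (21 / 20 * (x + 1)) ^ 2)).
  - apply Rmult_le_compat; [lra|apply pow2_ge_0|lra|].
    apply pow_incr; lra.
  - replace (3 / 5 * p * (21 / 20 * (x + 1)) ^ 2)%R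
      with (1323 / 2000 * (p * (x + 1) ^ 2))%R by field.
    apply Rmult_le_compat_r; [|lra].
    apply Rmult_le_pos; [lra|apply pow2_ge_0].
Qed.

(** * The quadratic transformation of the coefficients *)

(** Creative telescoping: [(n+1)(c+n) t(m,n+1) p_m - (a+n)(b+n) t(m,n) p_m]
    equals [X_(m-1) - X_m] with the certificate
    [X_m = 1/2 (m+1)(c+m) p_(m+1) t(m,n)].  Since X_m = 0 for m > n, the sums
    of t(m,n) p_m over m satisfy the recurrence of the Gauss coefficients. *)
Lemma gauss_recurrence_telescopes (a b c : C) (n M : nat)
  (Hc : forall k : nat, c + RtoC (INR k) <> 0) (Habc : c = a + b + 1 / 2) :
  let p := half_coef (2 * a) (2 * b) c in
  (RtoC (INR n) + 1) * (c + RtoC (INR n))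
    * sum_n (fun m => RtoC (root_coef m (S n)) * p m) M
  - (a + RtoC (INR n)) * (b + RtoC (INR n))
    * sum_n (fun m => RtoC (root_coef m n) * p m) M
  = - (1 / 2 * (RtoC (INR M) + 1) * (c + RtoC (INR M)) * p (S M)
       * RtoC (root_coef M n)).
Proof.
  intros p.
  pose proof (fun m => half_coef_S (2 * a) (2 * b) c m Hc) as Hp.
  fold p in Hp; clearbody p.
  induction M as [|M IH].
  - rewrite !sum_O.
    (* The recurrence of p turns the factor p_1 into p_0. *)
    transitivity (- (1 / 4 * (2 * (RtoC (INR 0) + 1) * (c + RtoC (INR 0)) * p 1%nat)
                     * RtoC (root_coef 0 n))); [|field].
    rewrite Hp, root_coef_0_S.
    destruct n as [|n]; [|rewrite root_coef_0_S]; cbn [INR root_coef]; field.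
  - set (k1 := (RtoC (INR n) + 1) * (c + RtoC (INR n))) in *.
    set (k2 := (a + RtoC (INR n)) * (b + RtoC (INR n))) in *.
    rewrite !sum_n_succ_C.
    match type of IH with k1 * ?s1 - k2 * ?s2 = _ =>
      transitivity (k1 * s1 - k2 * s2
        + (k1 * RtoC (root_coef (S M) (S n))
           - k2 * RtoC (root_coef (S M) n)) * p (S M)) end; [ring|].
    rewrite IH; clear IH; unfold k1, k2; clear k1 k2.
    (* Likewise p_(M+2) becomes p_(M+1), the common factor of all terms. *)
    transitivity (- (1 / 4 * (2 * (RtoC (INR (S M)) + 1) * (c + RtoC (INR (S M)))
                              * p (S (S M)))
                     * RtoC (root_coef (S M) n))); [|field].
    rewrite Hp, Habc.
    pose proof (root_coef_S (S M) n) as E1.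
    pose proof (root_coef_contiguous M n) as E2.
    cbn [pred] in E1.
    rewrite S_INR in *; rewrite RtoC_plus.
    revert E1 E2.
    generalize (root_coef (S M) (S n)) (root_coef (S M) n) (root_coef M n)
      (INR n) (INR M); intros t3 t2 t1 x y E1 E2.
    assert (C1 : 2 * (RtoC x + 1) * RtoC t3
      = (2 * RtoC x - (RtoC y + 1)) * RtoC t2 + (RtoC y + 1) * RtoC t1).
    { repeat first [rewrite <- RtoC_plus | rewrite <- RtoC_minus
                   | rewrite <- RtoC_mult]; f_equal; lra. }
    assert (C2 : RtoC y * (2 * RtoC x - RtoC y - 1) * RtoC t2
      = 2 * (RtoC y + 1) * (RtoC x - RtoC y) * RtoC t1).
    { repeat first [rewrite <- RtoC_plus | rewrite <- RtoC_minus
                   | rewrite <- RtoC_mult]; f_equal; exact E2. }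
    (* The recursion of t eliminates t(M+1,n+1), and what is left is a multiple
       of the contiguity relation. *)
    match goal with |- _ = ?r => transitivity
      (r + p (S M) *
       ((c + RtoC x) / 2
          * (2 * (RtoC x + 1) * RtoC t3
             - ((2 * RtoC x - (RtoC y + 1)) * RtoC t2 + (RtoC y + 1) * RtoC t1))
        - 1 / 4 * (RtoC y * (2 * RtoC x - RtoC y - 1) * RtoC t2
                   - 2 * (RtoC y + 1) * (RtoC x - RtoC y) * RtoC t1))) end.
    + rewrite Habc; field.
    + rewrite C1, C2; field.
Qed.

Lemma gauss_coef_quadratic (a b c : C) (n : nat)
  (Hc : forall k : nat, c + RtoC (INR k) <> 0) (Habc : c = a + b + 1 / 2) :
  sum_n (fun m => RtoC (root_coef m n) * half_coef (2 * a) (2 * b) c m) n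
  = gauss_coef a b c n :> C.
Proof.
  induction n as [|n IH].
  - rewrite sum_O; unfold half_coef, gauss_coef.
    cbn [pochhammer root_coef fact INR pow]; rewrite Rinv_1; field.
  - assert (Hn : (RtoC (INR n) + 1) * (c + RtoC (INR n)) <> 0).
    { apply Cmult_neq_0; [|apply Hc].
      rewrite <- RtoC_plus; intros E; apply (INR_succ_neq0 n), RtoC_inj, E. }
    set (k := (RtoC (INR n) + 1) * (c + RtoC (INR n))) in *.
    assert (scaled : forall x y, k * x = k * y -> x = y).
    { intros x y E; rewrite <- (Cmult_1_l x), <- (Cmult_1_l y), <- (Cinv_l k Hn).
      rewrite <- !Cmult_assoc, E; reflexivity. }
    apply scaled; unfold k; rewrite gauss_coef_S, <- IH by exact Hc.
    fold k; clear scaled IH.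
    pose proof (gauss_recurrence_telescopes a b c n (S n) Hc Habc) as E; cbv zeta in E.
    rewrite (root_coef_lt (S n) n), Cmult_0_r in E by lia.
    rewrite (sum_n_truncate
      (fun m => RtoC (root_coef m n) * half_coef (2 * a) (2 * b) c m) n (S n))
      in E; [|lia|intros m Hm; rewrite root_coef_lt by exact Hm; apply Cmult_0_l].
    fold k in E; revert E.
    match goal with |- ?x - ?y = _ -> _ => intros E;
      transitivity (x - y + y); [ring|rewrite E; ring] end.
Qed.

(** * Transformation of weighted series *)

(** If [W] is an eigenvector of the array t for the eigenvalue [lambda],
    then summing g_n = sum_m t(m,n) p_m against [W] multiplies the sum of
    p_m W_m by [lambda].  As [W 0 = 0], summing from n = 1 or from n = 0 makes
    no difference. *)
Lemma weighted_sums (a b c : C) (W : nat -> R) (lambda : R)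
  (Hc : forall k : nat, c + RtoC (INR k) <> 0) (Habc : c = a + b + 1 / 2)
  (W0 : W O = 0%R) (W_bound : forall n, (0 <= W n <= (INR n + 1) ^ 2)%R)
  (HW : forall m, is_series (fun n => (W n * root_coef m n)%R) (lambda * W m)%R) :
  exists s t : C,
    is_sum_from1 (fun n => gauss_coef (2 * a) (2 * b) c n * RtoC (W n / 2 ^ n)) s /\
    is_sum_from1 (fun n => gauss_coef a b c n * RtoC (W n)) t /\
    RtoC lambda * s = t.
Proof.
  set (p := half_coef (2 * a) (2 * b) c).
  assert (drop0 : forall (u : nat -> C) (l : C), u O = 0 ->
     @is_series C_AbsRing C_NormedModule u l -> is_sum_from1 u l).
  { intros u l Hu Hl; apply is_series_incr_1; rewrite Hu.
    exact (eq_ind_r (fun z => @is_series C_AbsRing C_NormedModule u z) Hl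
             (Cplus_0_r l)). }
  assert (pW_abs : ex_series (fun m => (Cmod (p m) * W m)%R)).
  { apply (ex_series_le (V:=R_CompleteNormedModule) _
             (fun m => (Cmod (p m) * (INR m + 1) ^ 2)%R));
      [|apply half_coef_summable, Hc].
    intros m; pose proof (Cmod_ge_0 (p m)); destruct (W_bound m).
    change (Rabs (Cmod (p m) * W m) <= Cmod (p m) * (INR m + 1) ^ 2)%R.
    rewrite Rabs_pos_eq by (apply Rmult_le_pos; lra).
    apply Rmult_le_compat_l; lra. }
  assert (pW_sum : @ex_series C_AbsRing C_NormedModule
                     (fun m => p m * RtoC (W m))).
  { apply (ex_series_le (V:=C_CompleteNormedModule) _
             (fun m => (Cmod (p m) * W m)%R)); [|exact pW_abs].
    intros m; change (Cmod (p m * RtoC (W m)) <= Cmod (p m) * W m)%R.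
    rewrite Cmod_mult, Cmod_R, Rabs_pos_eq by apply W_bound; lra. }
  destruct pW_sum as [s Hs].
  exists s, (RtoC lambda * s); split; [|split; [|reflexivity]].
  - apply drop0.
    + rewrite W0; unfold Rdiv; rewrite Rmult_0_l; apply Cmult_0_r.
    + refine (is_series_ext _ _ _ _ Hs); intros m.
      unfold p, half_coef, Rdiv; rewrite RtoC_mult.
      rewrite <- Cmult_assoc; f_equal; apply Cmult_comm.
  - apply drop0; [rewrite W0; apply Cmult_0_r|].
    apply (is_series_ext (fun n =>
      sum_n (fun m => RtoC (W n * root_coef m n) * p m) n)).
    { intros n; rewrite <- (gauss_coef_quadratic a b c n Hc Habc).
      rewrite <- (sum_n_mult_r (K:=C_Ring)).
      apply sum_n_ext; intros m; fold p.
      change (RtoC (W n * root_coef m n) * p m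
              = RtoC (root_coef m n) * p m * RtoC (W n)).
      rewrite RtoC_mult; ring. }
    apply (triangular_series (fun m n => (W n * root_coef m n)%R)
             (fun m => (lambda * W m)%R)).
    + intros m n; apply Rmult_le_pos; [apply W_bound|apply root_coef_ge0].
    + intros m n Hmn; rewrite root_coef_lt by exact Hmn; ring.
    + exact HW.
    + apply (ex_series_ext (fun m => scal lambda (Cmod (p m) * W m)%R)).
      * intros m; change (lambda * (Cmod (p m) * W m)
                          = Cmod (p m) * (lambda * W m))%R; ring.
      * exact (ex_series_scal_l (V:=R_NormedModule) lambda _ pW_abs).
    + apply (is_series_ext (fun m => scal (RtoC lambda) (p m * RtoC (W m)))).
      * intros m; change (RtoC lambda * (p m * RtoC (W m))
                          = p m * RtoC (lambda * W m)).
        rewrite RtoC_mult; ring.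
      * exact (is_series_scal_l (V:=C_NormedModule) (RtoC lambda) _ _ Hs).
Qed.

Theorem theorem1 (a b : C)
  (hab : forall z : Z, (z < 0)%Z -> a + b - 1 / 2 <> RtoC (IZR z)) :
  (exists s t : C,
     is_sum_from1 (fun n =>
       gauss_coef (2 * a) (2 * b) (a + b + 1 / 2) n
       * RtoC (harmonic 1 n / 2 ^ n)) s /\
     is_sum_from1 (fun n =>
       gauss_coef a b (a + b + 1 / 2) n
       * RtoC (harmonic 1 n)) t /\
     2 * s = t) /\
  (exists s t : C,
     is_sum_from1 (fun n =>
       gauss_coef (2 * a) (2 * b) (a + b + 1 / 2) n
       * RtoC ((harmonic 1 n ^ 2 + harmonic 2 n) / 2 ^ n)) s /\
     is_sum_from1 (fun n =>
       gauss_coef a b (a + b + 1 / 2) n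
       * RtoC (harmonic 1 n ^ 2 + harmonic 2 n)) t /\
     4 * s = t).
Proof.
  assert (Hc : forall k : nat, a + b + 1 / 2 + RtoC (INR k) <> 0).
  { intros k E; apply (hab (- Z.of_nat (S k))%Z); [lia|].
    rewrite opp_IZR, <- INR_IZR_INZ, S_INR, RtoC_opp, RtoC_plus.
    transitivity (a + b + 1 / 2 + RtoC (INR k) - (RtoC (INR k) + 1)); [field|].
    rewrite E; ring. }
  assert (H_bound : forall r n, (0 <= harmonic r n <= INR n)%R)
    by (split; [apply harmonic_ge0|apply harmonic_le]).
  split.
  - apply (weighted_sums a b _ (harmonic 1)); [exact Hc|reflexivity| | | ].
    + apply harmonic_0.
    + intros n; destruct (H_bound 1%nat n); nra.
    + apply root_coef_sum_harmonic.
  - apply (weighted_sums a b _ (fun n => (harmonic 1 n ^ 2 + harmonic 2 n)%R));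
      [exact Hc|reflexivity| | | ].
    + rewrite !harmonic_0; ring.
    + intros n; destruct (H_bound 1%nat n), (H_bound 2%nat n); nra.
    + apply root_coef_sum_harmonic_sq.
Qed.
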